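(* Let $\mathbf{E}$ be a Euclidean space and let $f_1,f_2\colon\mathbf{E}\to\overline{\mathbb{R}}$ be proper, lower-semicontinuous, convex functions. Then a set $F$ is a face of the sum $f_1+f_2$ if and only if $F$ coincides with $F_1\cap F_2$ for some face $F_1$ of $f_1$ and some face $F_2$ of $f_2$.
   Context: A Euclidean space is a finite-dimensional real inner product space; $\overline{\mathbb{R}}=\mathbb{R}\cup\{\pm\infty\}$; $\mathrm{epi}\,g=\{(x,r):g(x)\le r\}$ and $\mathrm{dom}\,g=\{x:g(x)<\infty\}$. A face of a convex set $Q$ is a convex subset $F\subset Q$ (the empty set being allowed) such that every closed segment in $Q$ whose relative interior meets $F$ lies fully in $F$. A set $F\subset\mathrm{dom}\,g$ is a face of a convex function $g$ if the set $\{(x,g(x)):x\in F\}$ is a face of $\mathrm{epi}\,g$. *)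

(* Defs.v *)
From HB Require Import structures.
From mathcomp Require Import all_boot all_order all_algebra.
From mathcomp Require Import all_classical all_reals all_analysis.
From mathcomp Require Import lra.

Set Implicit Arguments.
Unset Strict Implicit.
Unset Printing Implicit Defensive.

Import Order.TTheory GRing.Theory Num.Theory.
Import numFieldNormedType.Exports.

Local Open Scope classical_set_scope.
Local Open Scope ring_scope.

(* Euclidean spaces: the norm, and hence the topology, is the one induced by
   the inner product. *)
HB.mixin Record NormedVector_isEuclidean (R : realType) E
    & NormedModule R E & Vector R E := {
  inner : {dot E for (@idfun R)} ;
  inner_sqr_norm : forall x : E, inner x x = `|x| ^+ 2
}.

#[short(type="euclideanType")]
HB.structure Definition Euclidean (R : realType) :=
  {E of NormedVector_isEuclidean R E & NormedModule R E & Vector R E}.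

Section convex_geometry.
Context {R : realType} {V : normedModType R}.
Implicit Types (A Q F : set V) (x y : V).

Definition segment x y : set V :=
  [set (1 - t) *: x + t *: y | t in `[0, 1]].

Definition affine_set A :=
  forall x y (t : R), A x -> A y -> A ((1 - t) *: x + t *: y).

Definition affine_hull A : set V := smallest affine_set A.

Definition relative_interior A : set V :=
  [set x | A x /\ \forall y \near x, affine_hull A y -> A y].

Definition is_face Q F := [/\ convex_set F, F `<=` Q &
  forall x y, segment x y `<=` Q ->
    relative_interior (segment x y) `&` F !=set0 -> segment x y `<=` F].

(* When x = y both sides are the singleton [set x]. *)
Lemma relative_interior_segment x y :
  relative_interior (segment x y) =
  [set (1 - t) *: x + t *: y | t in `]0, 1[].
Proof.
have E t : (1 - t) *: x + t *: y = x + t *: (y - x).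
  by rewrite scalerBl scale1r scalerBr -addrA [- _ + _]addrC.
have [xy|xy] := eqVneq (y - x) 0.
  have S t : (1 - t) *: x + t *: y = x by rewrite E xy scaler0 addr0.
  apply/seteqP; split=> [z [[t _ <-] _]|z [t _ <-]].
    exists (2^-1); last by rewrite !S.
    by rewrite /= in_itv/= invr_gt0 ltr0n invf_lt1// ltr1n.
  split; first by exists 0; [rewrite /= in_itv/= lexx ler01|rewrite !S].
  have sx w : segment x y w <-> w = x.
    split=> [[s _ <-]|->]; first exact: S.
    by exists 0; [rewrite /= in_itv/= lexx ler01|rewrite S].
  apply: nearW => w /(_ (segment x y)); apply; split=> // a b s /sx -> /sx ->.
  by apply/sx; rewrite -scalerDl subrK scale1r.
have d0 : 0 < `|y - x| by rewrite normr_gt0.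
have aff t : affine_hull (segment x y) (x + t *: (y - x)).
  move=> B [aB sB]; rewrite -E; apply: aB; apply: sB.
    by exists 0; [rewrite /= in_itv/= lexx ler01|rewrite E scale0r addr0].
  by exists 1; [rewrite /= in_itv/= lexx ler01|rewrite E scale1r addrC subrK].
have inj s t : x + s *: (y - x) = x + t *: (y - x) -> s = t.
  move/addrI/eqP; rewrite -subr_eq0 -scalerBl scaler_eq0 (negPf xy) orbF.
  by rewrite subr_eq0 => /eqP.
apply/seteqP; split=> [z [[t t01 <-]]|z [t t01 <-]].
  rewrite E => /nbhs_ballP[e /= e0 he].
  have small s : `|s| * `|y - x| < e -> 0 <= t + s <= 1.
    move=> hs; have := he (x + (t + s) *: (y - x)).
    rewrite -ball_normE /= opprD addrACA subrr add0r -scalerBl opprD addrA subrr.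
    rewrite add0r scaleNr normrN normrZ => /(_ hs) /(_ (aff _))[u + Eu].
    by move: Eu; rewrite E => /inj <-; rewrite /= in_itv.
  have hc : `|e / 2 / `|y - x| | * `|y - x| < e.
    by rewrite ger0_norm ?divr_ge0 ?ltW// divfK ?gt_eqF// ltr_pdivrMr// ltr_pMr// ltr1n.
  have c0 : 0 < e / 2 / `|y - x| by rewrite !divr_gt0.
  have /andP[_ h1] := small _ hc.
  have /andP[h2 _] : 0 <= t + - (e / 2 / `|y - x|) <= 1 by apply: small; rewrite normrN.
  exists t; last by rewrite E.
  rewrite /= in_itv/=; apply/andP; split.
    by rewrite (lt_le_trans c0)// -subr_ge0.
  by rewrite (lt_le_trans _ h1)// ltrDl.
move: t01; rewrite /= in_itv/= => /andP[t0 t1].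
split; first by exists t => //; rewrite /= in_itv/= !ltW.
rewrite E; apply/nbhs_ballP; exists (Num.min t (1 - t) * `|y - x|) => /=.
  by rewrite mulr_gt0// lt_min t0 subr_gt0.
move=> w; rewrite -ball_normE /= => bw hw.
have [|s _ Es] := hw (range (fun s => x + s *: (y - x))).
  split=> [_ _ s [a _ <-] [b _ <-]|_ [s _ <-]]; last by exists s.
  exists ((1 - s) * a + s * b) => //.
  by move: (y - x) => d; rewrite !scalerDr !scalerA addrACA -!scalerDl subrK scale1r.
exists s; last by rewrite E.
move: bw; rewrite -Es opprD addrACA subrr add0r -scalerBl normrZ ltr_pM2r//.
rewrite lt_min => /andP[/ltr_normlP[_ h1] /ltr_normlP[h2 _]].
by rewrite /= in_itv/=; apply/andP; split; lra.
Qed.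

End convex_geometry.

Section extended_real_functions.
Context {R : realType} {E : normedModType R}.
Implicit Types (g : E -> \bar R) (F : set E).
Local Open Scope ereal_scope.

Definition epi g : set (E * R^o) := [set p | g p.1 <= p.2%:E].

Definition dom g : set E := [set x | g x < +oo].

Definition proper_fun g := (forall x, g x != -oo) /\ dom g !=set0.

Definition convex_fun g := convex_set (epi g).

(* A point (x, g x) belongs to E * R only where g x is finite. *)
Definition graph_over g F : set (E * R^o) :=
  [set p | F p.1 /\ g p.1 = p.2%:E].

Definition is_fun_face g F := F `<=` dom g /\ is_face (epi g) (graph_over g F).

End extended_real_functions.

(* Main.v *)
(* For the nontrivial direction, a nonempty convex set F in finite dimension
   contains a point z such that every segment from a point of F to z can be
   prolonged within F beyond z. Let F_i be the projection of the smallest face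
   of epi f_i containing (z, f_i z). It is a face of f_i and contains F, because
   f_1 and f_2, having affine sum on F, are both affine there. Conversely, if y
   lies in F_1 and F_2, then f_1 and f_2, hence f_1 + f_2, are affine on a common
   segment from y through z, so y lies in F because F is a face of f_1 + f_2. *)

Require Import Defs.
From mathcomp Require Import all_boot all_order all_algebra.
From mathcomp Require Import all_classical all_reals all_analysis.
From mathcomp Require Import ring lra.

Local Open Scope classical_set_scope.

Set Implicit Arguments.
Unset Strict Implicit.
Unset Printing Implicit Defensive.

Import Order.TTheory GRing.Theory Num.Theory.

Local Open Scope ring_scope.

(** * Prolonged segments and the face generated by a point *)

Section convexity.
Context {R : realType} {V : lmodType R}.
Implicit Types (A Q : set V) (p x y z d : V).

(* Vector identities reduce to scalar ones by rewriting every vector as a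
   linear combination [f a b c] of three atoms. *)
Lemma lin_comb3 x y z : exists f : R -> R -> R -> V,
  [/\ x = f 1 0 0, y = f 0 1 0, z = f 0 0 1,
      (forall k a b c, k *: f a b c = f (k * a) (k * b) (k * c)) &
      (forall a b c a' b' c',
         f a b c + f a' b' c' = f (a + a') (b + b') (c + c')) /\
      (forall a b c, - f a b c = f (- a) (- b) (- c))].
Proof.
exists (fun a b c => a *: x + b *: y + c *: z).
split=> [|||k a b c|]; rewrite ?scale1r ?scale0r ?addr0 ?add0r//.
  by rewrite !scalerDr !scalerA.
split=> [a b c a' b' c'|a b c]; last by rewrite !scaleNr !opprD.
by rewrite !scalerDl addrACA; congr (_ + _); rewrite addrACA.
Qed.

Lemma convex_setE A : convex_set A <->
  forall x y (s : R), 0 <= s <= 1 -> A x -> A y -> A ((1 - s) *: x + s *: y).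
Proof.
split=> [cA x y s /andP[s0 s1] Ax Ay|cA x y s].
  have := cA y x (Itv01 s0 s1); rewrite !inE => /(_ Ay Ax).
  by rewrite /conv/= addrC.
rewrite !inE => Ax Ay; rewrite /conv/= addrC.
by apply: cA => //; apply/andP; split.
Qed.

(* For convex [Q] containing [p], the smallest face of [Q] containing [p]. *)
Definition face_generated Q p : set V :=
  [set y | Q y /\ exists2 e : R, 0 < e & Q (p + e *: (p - y))].

(** The shorter prolongation lies between [p] and the longer one. This lets two prolongations be cut
    to a common length. *)
Lemma convex_extrapolation Q p y (e e' : R) : convex_set Q -> Q p ->
  0 <= e' <= e -> Q (p + e *: (p - y)) -> Q (p + e' *: (p - y)).
Proof.
move=> /convex_setE cQ Qp /andP[e'0 e'e] Qe.
have [e0|e0] := eqVneq e 0.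
  have -> : e' = e by rewrite e0; apply/eqP; rewrite eq_le e'0 -{1}e0 e'e.
  by [].
have e_gt0 : 0 < e by rewrite lt_neqAle eq_sym e0 (le_trans e'0).
have := cQ _ _ (e' / e) _ Qp Qe; rewrite scalerDr scalerA divfK// addrA.
rewrite -scalerDl subrK scale1r; apply.
by rewrite divr_ge0 ?(ltW e_gt0)//= ler_pdivrMr// mul1r.
Qed.

(** Once [x] and [y] are prolonged through [p] by the same factor, prolongation commutes with convex
    combination. *)
Lemma face_generated_convex Q p : convex_set Q -> Q p ->
  convex_set (face_generated Q p).
Proof.
move=> cQ Qp; have cQ' := (convex_setE Q).1 cQ.
apply/convex_setE => x y s s01 [Qx [e e0 he]] [Qy [e' e'0 he']].
split; first exact: cQ'.
have m0 : 0 < Num.min e e' by rewrite lt_min e0 e'0.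
exists (Num.min e e') => //; set m := Num.min e e' in m0 *.
have hm : Q (p + m *: (p - x)).
  by apply: convex_extrapolation he; rewrite // (ltW m0) ge_min lexx.
have hm' : Q (p + m *: (p - y)).
  by apply: convex_extrapolation he'; rewrite // (ltW m0) ge_min lexx orbT.
have := cQ' _ _ s s01 hm hm'; congr Q.
have [f [-> -> -> fZ [fD fN]]] := lin_comb3 p x y.
by rewrite !(fZ, fD, fN); congr f; ring.
Qed.

Lemma face_generated_extreme Q p x y (s : R) : convex_set Q ->
  0 < s < 1 -> Q x -> Q y -> face_generated Q p ((1 - s) *: x + s *: y) ->
  face_generated Q p x.
Proof.
move=> /convex_setE cQ /andP[s0 s1] Qx Qy [_ [e e0 he]]; split=> //.
have es : 0 < 1 + e * s by rewrite addr_gt0// mulr_gt0.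
(* The prolongation from [(1 - s) *: x + s *: y] through [p] contains [- (e * s) *: y]. Mixing it
   with [y] at weight [e * s / (1 + e * s)] cancels that term and leaves a prolongation from [x],
   with this factor. *)
exists (e * (1 - s) / (1 + e * s)).
  by rewrite divr_gt0// mulr_gt0// subr_gt0.
have u01 : 0 <= e * s / (1 + e * s) <= 1.
  rewrite ler_pdivrMr// mul1r lerDr ler01 andbT.
  by rewrite divr_ge0 ?(ltW es)// mulr_ge0// ltW.
have := cQ _ _ _ u01 he Qy; congr Q.
have [f [-> -> -> fZ [fD fN]]] := lin_comb3 p x y.
by rewrite !(fZ, fD, fN); congr f; field; rewrite gt_eqF.
Qed.

Lemma between_extrapolation p y (e : R) : 0 < e ->
  (1 - (1 + e)^-1) *: y + (1 + e)^-1 *: (p + e *: (p - y)) = p.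
Proof.
move=> e0; have [f [-> -> _ fZ [fD fN]]] := lin_comb3 p y 0.
by rewrite !(fZ, fD, fN); congr f; field; rewrite gt_eqF// addr_gt0.
Qed.

End convexity.

Lemma inv1D_in01 {R : realType} (e : R) : 0 < e -> 0 < (1 + e)^-1 < 1.
Proof.
by move=> e0; rewrite invr_gt0 addr_gt0//= invf_lt1 ?addr_gt0// ltrDl.
Qed.

(** * Existence of a generating point in finite dimension *)

Section relative_interior_point.
Context {R : realType} {V : vectType R}.
Implicit Types (A : set V) (p x y d : V).

(** When [A] is convex and contains [p], these directions form a linear subspace. *)
Let line_dir A p d := exists2 e : R, 0 < e &
  forall u : R, `|u| <= e -> A (p + u *: d).

Let line_dirZ A p d (k : R) : line_dir A p d -> line_dir A p (k *: d).
Proof.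
move=> [e e0 he]; have k0 : 0 < 1 + `|k| by rewrite ltr_pwDl.
(* Adding 1 keeps the denominator positive when [k] is zero. *)
exists (e / (1 + `|k|)) => [|u]; first by rewrite divr_gt0.
rewrite ler_pdivlMr// scalerA => hu; apply: he; rewrite normrM.
by apply: le_trans hu; rewrite ler_wpM2l// lerDr.
Qed.

Let line_dirD A p d d' : convex_set A ->
  line_dir A p d -> line_dir A p d' -> line_dir A p (d + d').
Proof.
move=> /convex_setE cA [e e0 he] [e' e'0 he'].
(* [p + u *: (d + d')] is the midpoint of [p + (u * 2) *: d] and [p + (u * 2) *: d'], which explains
   the halved radius. *)
exists (Num.min e e' / 2) => [|u]; first by rewrite divr_gt0// lt_min e0 e'0.
rewrite ler_pdivlMr// le_min => /andP[hu hu'].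
have n2 : `|u * 2| = `|u| * 2 by rewrite normrM normr_nat.
have h01 : 0 <= (2^-1 : R) <= 1 by rewrite invr_ge0 ler0n invf_le1// ler1n.
have := cA _ _ _ h01 (he (u * 2) _) (he' (u * 2) _).
rewrite !n2 => /(_ hu hu'); congr A.
have [f [-> -> -> fZ [fD fN]]] := lin_comb3 p d d'.
by rewrite !(fZ, fD, fN); congr f; field.
Qed.

(* A point [p] at which the space of directions of segments of [A] through [p]
   has maximal dimension: passing to the midpoint of [p] and any [y] in [A]
   keeps these directions and adds [y - p]. *)
Lemma exists_face_generator A : convex_set A -> A !=set0 ->
  exists2 p, A p & A `<=` face_generated A p.
Proof.
move=> cA [x0 Ax0]; have cA' := (convex_setE A).1 cA.
pose good n := `[< exists p (U : {vspace V}),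
  [/\ A p, (forall d, d \in U -> line_dir A p d) & \dim U = n] >].
have ex_good : exists n, good n.
  exists 0%N; apply/asboolP; exists x0, 0%VS; split=> //; last exact: dimv0.
  by move=> d /[!memv0]/eqP->; exists 1 => // u _; rewrite scaler0 addr0.
have good_le n : good n -> (n <= \dim {:V})%N.
  by move=> /asboolP[p [U [_ _ <-]]]; rewrite dimvS// subvf.
case: (ex_maxnP ex_good good_le) => n /asboolP[p [U [Ap Udir dimU]]] maxn.
exists p => // y Ay; split=> //.
have h01 : 0 <= (2^-1 : R) <= 1 by rewrite invr_ge0 ler0n invf_le1// ler1n.
pose m := (1 - 2^-1) *: p + 2^-1 *: y.
have Udir_m d : d \in U -> line_dir A m d.
  move=> /Udir[e e0 he]; exists (e / 2) => [|u]; first by rewrite divr_gt0.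
  rewrite ler_pdivlMr// => hu.
  have n2 : `|u * 2| <= e by rewrite normrM normr_nat.
  have := cA' _ _ _ h01 (he _ n2) Ay; congr A; rewrite /m.
  have [f [-> -> -> fZ [fD fN]]] := lin_comb3 p d y.
  by rewrite !(fZ, fD, fN); congr f; field.
have dir_m : line_dir A m (y - p).
  exists 2^-1 => [|u]; first by rewrite invr_gt0.
  rewrite ler_norml => /andP[u1 u2].
  have u01 : 0 <= 2^-1 + u <= 1 by apply/andP; split; lra.
  have := cA' _ _ _ u01 Ap Ay; congr A; rewrite /m.
  have [f [-> -> _ fZ [fD fN]]] := lin_comb3 p y 0.
  by rewrite !(fZ, fD, fN); congr f; field.
(* Maximality of [n] prevents the enlarged space at [m] from exceeding [U] in dimension, so [y - p]
   was already a direction at [p]. *)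
have /maxn dim_le : good (\dim (U + <[y - p]>)).
  apply/asboolP; exists m, (U + <[y - p]>)%VS; split=> //; first exact: cA'.
  move=> _ /memv_addP[d dU [_ /vlineP[k ->] ->]].
  by apply: line_dirD => //; [exact: Udir_m|exact: line_dirZ].
have yU : y - p \in U.
  have /eqP -> : U == (U + <[y - p]>)%VS by rewrite eqEdim addvSl dimU.
  by rewrite memvE addvSr.
have [e e0 he] := Udir _ yU; exists e => //.
by have := he (- e); rewrite normrN gtr0_norm// scaleNr -scalerN opprB; apply.
Qed.

End relative_interior_point.

(** * Faces of convex sets in terms of endpoints *)

Section faces.
Context {R : realType} {V : normedModType R}.
Implicit Types (Q F : set V) (x y : V).

Lemma segment_left x y : segment x y x.
Proof.
exists 0; first by rewrite /= in_itv/= lexx ler01.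
by rewrite subr0 scale1r scale0r addr0.
Qed.

Lemma segment_right x y : segment x y y.
Proof.
exists 1; first by rewrite /= in_itv/= lexx ler01.
by rewrite subrr scale1r scale0r add0r.
Qed.

(** By convexity of [Q] and [F], a segment lies in either set as soon as its endpoints do; its
    relative interior is the image of the open parameter interval. *)
Lemma is_faceE Q F : convex_set Q -> is_face Q F <->
  [/\ convex_set F, F `<=` Q & forall x y (s : R), 0 < s < 1 ->
    Q x -> Q y -> F ((1 - s) *: x + s *: y) -> F x /\ F y].
Proof.
move=> /convex_setE cQ; split=> -[cF FQ face].
  split=> // x y s s01 Qx Qy Fs.
  have sub : segment x y `<=` F.
    apply: face => [_ [t t01 <-]|].
      by apply: cQ => //; move: t01; rewrite /= in_itv.
    exists ((1 - s) *: x + s *: y); split=> //.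
    by rewrite relative_interior_segment; exists s => //=; rewrite in_itv.
  by split; apply: sub; [exact: segment_left|exact: segment_right].
split=> // x y sQ [z []]; rewrite relative_interior_segment.
move=> [s]; rewrite /= in_itv/= => s01 <- Fs.
have [Fx Fy] : F x /\ F y.
  by apply: face Fs => //; apply: sQ; [exact: segment_left|exact: segment_right].
by move=> _ [t t01 <-]; apply: (convex_setE F).1.
Qed.

Lemma is_face_generated Q p : convex_set Q -> Q p ->
  is_face Q (face_generated Q p).
Proof.
move=> cQ Qp; apply/is_faceE => //; split=> [|y []//|x y s s01 Qx Qy gs].
  exact: face_generated_convex.
split; first exact: face_generated_extreme gs.
have s01' : 0 < 1 - s < 1 by move: s01 => /andP[? ?]; apply/andP; split; lra.
apply: (face_generated_extreme (s := 1 - s)) Qy Qx _ => //.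
by rewrite subKr addrC.
Qed.

End faces.

(** * Faces of convex functions *)

Section fun_faces.
Context {R : realType} {E : normedModType R}.
Implicit Types (g : E -> \bar R) (F : set E).

(** Real upper bounds in place of the values of [g] avoid convex combinations of infinities. *)
Lemma convex_funE g : convex_fun g <->
  forall x y (a b s : R), 0 <= s <= 1 -> (g x <= a%:E)%E -> (g y <= b%:E)%E ->
    (g ((1 - s) *: x + s *: y)%R <= ((1 - s) * a + s * b)%:E)%E.
Proof.
split=> [/convex_setE cg x y a b s s01 ga gb|cg].
  exact: (cg (x, a) (y, b)).
by apply/convex_setE => -[x a] [y b] s s01; apply: cg.
Qed.

(** This is [is_faceE] for the epigraph: convexity of the graph makes [F] convex and [g] affine on
    it. *)
Lemma is_fun_faceE g F : convex_fun g -> is_fun_face g F <->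
  [/\ F `<=` dom g,
      (forall x y (a b s : R), 0 <= s <= 1 -> F x -> F y ->
         g x = a%:E -> g y = b%:E ->
         F ((1 - s) *: x + s *: y) /\
         g ((1 - s) *: x + s *: y) = ((1 - s) * a + s * b)%:E) &
      (forall x y (a b s : R), 0 < s < 1 ->
         (g x <= a%:E)%E -> (g y <= b%:E)%E ->
         F ((1 - s) *: x + s *: y) ->
         g ((1 - s) *: x + s *: y) = ((1 - s) * a + s * b)%:E ->
         (F x /\ g x = a%:E) /\ (F y /\ g y = b%:E))].
Proof.
move=> cg; split=> [[Fdom /(is_faceE _ cg)[cF _ face]]|[Fdom cF face]].
  split=> // x y a b s s01; last first.
    by move=> ga gb Fs gs; exact: (face (x, a) (y, b) s).
  by move=> Fx Fy ga gb; exact: ((convex_setE _).1 cF (x, a) (y, b)).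
split=> //; apply/is_faceE => //; split.
- by apply/convex_setE => -[x a] [y b] s s01 [Fx ga] [Fy gb]; apply: cF.
- by move=> [x a] [_ /= ga]; rewrite /epi/= ga.
- by move=> [x a] [y b] s s01 ga gb [Fs gs]; apply: face gs.
Qed.

Lemma fun_face_generated g z (c : R) :
  convex_fun g -> (forall x, g x != -oo%E) -> g z = c%:E ->
  is_fun_face g [set y | exists2 r : R, g y = r%:E &
                         face_generated (epi g) (z, c) (y, r)].
Proof.
move=> cg gNy gz; split=> [y [r gy _]|]; first by rewrite /dom/= gy ltry.
have epiz : epi g (z, c) by rewrite /epi/= gz.
rewrite (_ : graph_over _ _ = face_generated (epi g) (z, c)).
  exact: is_face_generated.
apply/seteqP; split=> [[y r] [[r' /= -> gen] [<-]]//|[y r] gen].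
(* No generated point lies strictly above the graph: lowering [(y, r)] to [(y, r')] with [r' < r]
   and keeping the prolonged point would put a point of the epigraph strictly below [(z, c)]. *)
suff gy : g y = r%:E by split=> //; exists r.
have [gyr [e e0 /= he]] := gen; rewrite /epi/= in gyr he.
case gyE : (g y) => [r'| |]; last 2 first.
- by move: gyr; rewrite gyE.
- by have := gNy y; rewrite gyE.
move: gyr; rewrite gyE lee_fin => r'r; congr EFin.
apply/eqP; rewrite eq_le r'r /=.
have /andP[s0 s1] := inv1D_in01 e0.
have := (convex_funE g).1 cg
  y (z + e *: (z - y)) r' (c + e * (c - r)) (1 + e)^-1.
rewrite between_extrapolation// gz gyE lee_fin lexx.
move=> /(_ _ isT he); rewrite (ltW s0) (ltW s1) => /(_ isT).
rewrite lee_fin [leRHS](_ : _ = c + e * (r' - r) / (1 + e)); last first.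
  by field; rewrite gt_eqF// addr_gt0.
by rewrite lerDl pmulr_lge0// pmulr_rge0// subr_ge0.
Qed.

End fun_faces.

Lemma adde_eq_fin {R : realType} (u v : \bar R) (a : R) : (u + v = a%:E)%E ->
  exists b c, [/\ u = b%:E, v = c%:E & a = b + c].
Proof. by case: u v => [b| |] [c| |]//= [<-]; exists b, c. Qed.

(** The value [-oo] must be excluded, since [+oo + -oo] is [-oo] by convention. *)
Lemma adde_le_fin {R : realType} (u v : \bar R) (a : R) :
  u != -oo%E -> v != -oo%E -> (u + v <= a%:E)%E ->
  exists b c, [/\ u = b%:E, v = c%:E & b + c <= a].
Proof.
by case: u v => [b| |] [c| |]//= _ _; rewrite -EFinD lee_fin; exists b, c.
Qed.

(** * Intersections of faces are faces of the sum *)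

Section sum_of_convex_functions.
Context {R : realType} {E : normedModType R} (f1 f2 : E -> \bar R).
Hypotheses (f1Ny : forall x, f1 x != -oo%E) (f2Ny : forall x, f2 x != -oo%E).
Hypotheses (cf1 : convex_fun f1) (cf2 : convex_fun f2).

Lemma convex_funD : convex_fun (f1 \+ f2)%E.
Proof.
apply/convex_funE => x y a b s s01 /adde_le_fin[]// a1 [a2 [x1 x2 ha]].
move=> /adde_le_fin[]// b1 [b2 [y1 y2 hb]].
have := (convex_funE f1).1 cf1 x y a1 b1 s s01.
have := (convex_funE f2).1 cf2 x y a2 b2 s s01.
rewrite x1 x2 y1 y2 !lee_fin !lexx => /(_ isT isT) h2 /(_ isT isT) h1.
apply: (le_trans (leeD h1 h2)); rewrite -EFinD lee_fin.
by move: s01 => /andP[s0 s1]; nra.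
Qed.

(** If the convexity inequalities of [f1] and [f2] add up to an equality, each is an equality, so
    each face condition applies separately. *)
Lemma fun_faceI F1 F2 : is_fun_face f1 F1 -> is_fun_face f2 F2 ->
  is_fun_face (f1 \+ f2)%E (F1 `&` F2).
Proof.
move=> /(is_fun_faceE _ cf1)[dom1 conv1 face1].
move=> /(is_fun_faceE _ cf2)[dom2 conv2 face2].
apply/is_fun_faceE; first exact: convex_funD.
split=> [x [Fx1 Fx2]|x y a b s s01|x y a b s s01].
- by rewrite /dom/=; apply: lte_add_pinfty; [exact: dom1|exact: dom2].
- move=> [Fx1 Fx2] [Fy1 Fy2] /adde_eq_fin[a1 [a2 [x1 x2 ->]]].
  move=> /adde_eq_fin[b1 [b2 [y1 y2 ->]]].
  have [F1s ->] := conv1 _ _ _ _ _ s01 Fx1 Fy1 x1 y1.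
  have [F2s ->] := conv2 _ _ _ _ _ s01 Fx2 Fy2 x2 y2.
  by split=> //; rewrite -EFinD; congr EFin; ring.
move=> /adde_le_fin[]// a1 [a2 [x1 x2 ha]].
move=> /adde_le_fin[]// b1 [b2 [y1 y2 hb]] [F1s F2s].
move=> /adde_eq_fin[c1 [c2 [z1 z2 hc]]].
have /andP[s0 s1] := s01.
have s01' : 0 <= s <= 1 by rewrite !ltW.
have := (convex_funE f1).1 cf1 x y a1 b1 s s01'.
have := (convex_funE f2).1 cf2 x y a2 b2 s s01'.
rewrite x1 x2 y1 y2 z1 z2 !lee_fin !lexx => /(_ isT isT) h2 /(_ isT isT) h1.
have sa : (1 - s) * (a1 + a2) <= (1 - s) * a by rewrite ler_pM2l// subr_gt0.
have sb : s * (b1 + b2) <= s * b by rewrite ler_pM2l.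
(* By [h1], [h2] and [hc], the inequalities [sa] and [sb] are equalities; the positive weights then
   cancel. *)
have ea : a = a1 + a2.
  by apply: (mulfI (x := 1 - s)); [rewrite gt_eqF// subr_gt0|lra].
have eb : b = b1 + b2 by apply: (mulfI (x := s)); [rewrite gt_eqF|lra].
have e1 : c1 = (1 - s) * a1 + s * b1 by subst a b; lra.
have e2 : c2 = (1 - s) * a2 + s * b2 by subst a b; lra.
have [|||//|[Fx1 _] [Fy1 _]] := face1 x y a1 b1 s s01; rewrite ?x1 ?y1 ?z1 ?e1//.
have [|||//|[Fx2 _] [Fy2 _]] := face2 x y a2 b2 s s01; rewrite ?x2 ?y2 ?z2 ?e2//.
by rewrite ea eb.
Qed.

End sum_of_convex_functions.

(** * Every face of the sum is an intersection of faces *)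

Section faces_of_sum.
Context {R : realType} {E : euclideanType R} (f1 f2 : E -> \bar R).
Hypotheses (f1Ny : forall x, f1 x != -oo%E) (f2Ny : forall x, f2 x != -oo%E).
Hypotheses (cf1 : convex_fun f1) (cf2 : convex_fun f2).

Lemma fun_face_sum F : is_fun_face (f1 \+ f2)%E F ->
  exists F1 F2, [/\ is_fun_face f1 F1, is_fun_face f2 F2 & F = F1 `&` F2].
Proof.
move=> /is_fun_faceE[]; first exact: convex_funD.
move=> Fdom Fconv face.
(* The empty face has no generating point, but it is a face of both summands. *)
have [->|F0] := eqVneq F set0.
  have empty_face (g : E -> \bar R) : convex_fun g -> is_fun_face g set0.
    move=> cg; apply/(is_fun_faceE _ cg).
    by split=> [x|x y a b s _|x y a b s _ _ _] [].
  by exists set0, set0; rewrite set0I; split=> //; exact: empty_face.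
have Ffin x : F x -> exists a1 a2, f1 x = a1%:E /\ f2 x = a2%:E.
  move=> /Fdom; have := f1Ny x; have := f2Ny x; rewrite /dom/=.
  by case: (f1 x) (f2 x) => [a1| |] [a2| |]// _ _ _; exists a1, a2.
have cF : convex_set F.
  apply/convex_setE => x y s s01 Fx Fy.
  have [a1 [a2 [x1 x2]]] := Ffin x Fx; have [b1 [b2 [y1 y2]]] := Ffin y Fy.
  have := Fconv x y (a1 + a2) (b1 + b2) s s01 Fx Fy.
  by rewrite x1 x2 y1 y2 => /(_ erefl erefl)[].
have [z Fz gen] : exists2 p, F p & F `<=` face_generated F p.
  by apply: exists_face_generator => //; exact/set0P.
have [c1 [c2 [z1 z2]]] := Ffin z Fz.
exists [set y | exists2 r : R, f1 y = r%:E &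
                face_generated (epi f1) (z, c1) (y, r)].
exists [set y | exists2 r : R, f2 y = r%:E &
                face_generated (epi f2) (z, c2) (y, r)].
split; [exact: fun_face_generated|exact: fun_face_generated|].
apply/seteqP; split=> [y Fy|y [[r1 y1 [_ [e e0 he]]] [r2 y2 [_ [e' e'0 he']]]]].
  have [_ [e e0 Fw]] := gen _ Fy; set w := z + e *: (z - y) in Fw.
  have [r1 [r2 [y1 y2]]] := Ffin y Fy; have [b1 [b2 [w1 w2]]] := Ffin w Fw.
  have /andP[s0 s1] := inv1D_in01 e0.
  have s01 : 0 <= (1 + e)^-1 <= 1 by rewrite !ltW.
  have := Fconv y w (r1 + r2) (b1 + b2) _ s01 Fy Fw.
  rewrite y1 y2 w1 w2 between_extrapolation// z1 z2.
  move=> /(_ erefl erefl)[_ [hc]].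
  have := (convex_funE f1).1 cf1 y w r1 b1 _ s01.
  have := (convex_funE f2).1 cf2 y w r2 b2 _ s01.
  rewrite y1 y2 w1 w2 between_extrapolation// z1 z2 !lee_fin !lexx.
  move=> /(_ isT isT) h2 /(_ isT isT) h1.
  have e1 : 1 + e != 0 by rewrite gt_eqF// addr_gt0.
  (* [hc] turns [h1] and [h2] into equalities. Solving them for the values at [w] shows that the
     prolongations from [(y, r1)] and [(y, r2)] end on the graphs of [f1] and [f2]. *)
  have scal (c r b : R) : c = (1 - (1 + e)^-1) * r + (1 + e)^-1 * b ->
      b = c + e * (c - r) by move=> ->; field.
  split; [exists r1 => //|exists r2 => //].
    split; rewrite /epi/= ?y1//; exists e => //=.
    by rewrite w1 lee_fin (scal c1 r1 b1)//; lra.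
  split; rewrite /epi/= ?y2//; exists e => //=.
  by rewrite w2 lee_fin (scal c2 r2 b2)//; lra.
(* A common factor places both prolonged points over the same point of [E], so their heights add up
   to a bound for the sum there. *)
have m0 : 0 < Num.min e e' by rewrite lt_min e0 e'0.
set m := Num.min e e' in m0.
have hm1 : epi f1 ((z, c1) + m *: ((z, c1) - (y, r1))).
  apply: convex_extrapolation he; rewrite // /epi/= ?z1// (ltW m0).
  by rewrite ge_min lexx.
have hm2 : epi f2 ((z, c2) + m *: ((z, c2) - (y, r2))).
  apply: convex_extrapolation he'; rewrite // /epi/= ?z2// (ltW m0).
  by rewrite ge_min lexx orbT.
have := face y (z + m *: (z - y)) (r1 + r2)
  ((c1 + m * (c1 - r1)) + (c2 + m * (c2 - r2))) _ (inv1D_in01 m0).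
rewrite between_extrapolation// y1 y2 lexx z1 z2.
case=> //; first by rewrite EFinD; apply: leeD.
  by rewrite -EFinD; congr EFin; field; rewrite gt_eqF// addr_gt0.
by case.
Qed.

End faces_of_sum.

Theorem corollary2p5 (R : realType) (E : euclideanType R)
    (f1 f2 : E -> \bar R)
    (f1_proper : proper_fun f1) (f2_proper : proper_fun f2)
    (f1_lsc : lower_semicontinuous f1) (f2_lsc : lower_semicontinuous f2)
    (f1_convex : convex_fun f1) (f2_convex : convex_fun f2)
    (F : set E) :
  is_fun_face (f1 \+ f2)%E F <->
  exists F1 F2 : set E,
    [/\ is_fun_face f1 F1, is_fun_face f2 F2 & F = F1 `&` F2].
Proof.
case: f1_proper f2_proper => [f1Ny _] [f2Ny _].
split=> [|[F1 [F2 [face1 face2 ->]]]]; first exact: fun_face_sum.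
exact: fun_faceI.
Qed.
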